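(* Let $B\ge 1$, $\Omega=\{\omega_1,\omega_2\}$, $\mathcal F=2^\Omega$, $X(\omega_1)=B$, $X(\omega_2)=0$. Let $\phi$ be a divergence function such that $[1-\delta,1+\delta]\subseteq \mathrm{int}(\mathrm{dom}(\phi))$ for some $\delta>0$ and $\lim_{x\to\infty}\phi(x)/x=\infty$, and let $\tau>0$. Then there exists $\epsilon_{\phi,\tau}>0$ with the property that for any $\epsilon\in(0,\epsilon_{\phi,\tau})$ there is a probability measure $P$ on $(\Omega,\mathcal F)$ with $\mathcal R^P(X)\ge\epsilon$ and $P(\omega_1)=\frac{\epsilon/B}{g_\phi^{-1}(\tau B/(2\epsilon))}$, and such that the following holds: for any $\epsilon\in(0,\epsilon_{\phi,\tau})$, any positive integer $$n\le \frac{g_\phi^{-1}(\tau B/(2\epsilon))\,B}{2\epsilon},$$ and any estimator $\hat{\mathcal R}_n(X):\Omega^n\to\mathbb R$ that is $\mathcal F^{\otimes n}$-measurable (a function of $n$ i.i.d. samples), there exists a probability measure $P$ on $(\Omega,\mathcal F)$ such that $$P^{\otimes n}\Big(\big|\hat{\mathcal R}_n(X)-\mathcal R^P(X)\big|\ge\tfrac{\epsilon}{2}\Big)\ge\tfrac14 .$$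
   Context: A divergence function is a convex lower semicontinuous $\phi:\mathbb R\to[0,\infty]$ with $\phi(1)=0$ and $\phi(x)=+\infty$ for $x<0$. For a probability measure $P$ on a measurable space $(\Omega,\mathcal F)$, a radius $\tau$ and a bounded measurable $X:\Omega\to\mathbb R$, the distributionally robust functional is $$\mathcal R(X)=\mathcal R^P(X)=\sup\Big\{\int_\Omega X\zeta\,dP:\ \zeta\ge 0 \text{ measurable},\ \int_\Omega\zeta\,dP=1,\ \int_\Omega\phi(\zeta)\,dP\le\tau\Big\}.$$ When $\lim_{x\to\infty}\phi(x)/x=\infty$, the growth function is $g_\phi(x)=\inf_{x'\ge x}\phi(x')/x'$ for $x\ge1$ and $g_\phi(x)=\infty$ otherwise, and its inverse is $g_\phi^{-1}(y)=\inf\{x: x\ge1,\ g_\phi(x)\ge y\}$ for $y>0$. *)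

(* Defs.v *)
From HB Require Import structures.
From mathcomp Require Import all_boot all_order all_algebra.
From mathcomp Require Import all_classical all_reals all_analysis.

Set Implicit Arguments.
Unset Strict Implicit.
Unset Printing Implicit Defensive.

Import Order.TTheory GRing.Theory Num.Theory.
Import numFieldNormedType.Exports.

Local Open Scope classical_set_scope.
Local Open Scope ring_scope.

(* In [divergence_convex] the library convention 0 * +oo = 0 is the usual one of
   convex analysis, so the endpoints t = 0 and t = 1 impose nothing. *)
Record divergence_function (R : realType) (phi : R -> \bar R) : Prop := {
  divergence_ge0 : forall x, (0 <= phi x)%E ;
  divergence_convex : forall x y t : R, 0 <= t <= 1 ->
    (phi (t * x + (1 - t) * y)%R <= t%:E * phi x + (1 - t)%:E * phi y)%E ;
  divergence_lsc : lower_semicontinuous phi ;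
  divergence1 : phi 1 = 0%E ;
  divergence_neg : forall x, x < 0 -> phi x = +oo%E }.

Definition edom (R : realType) (phi : R -> \bar R) : set R :=
  [set x | (phi x < +oo)%E].

Definition superlinear (R : realType) (phi : R -> \bar R) : Prop :=
  (phi x / x%:E)%E @[x --> +oo%R] --> +oo%E.

Definition growth (R : realType) (phi : R -> \bar R) (x : R) : \bar R :=
  if 1 <= x then ereal_inf [set (phi x' / x'%:E)%E | x' in [set x' | x <= x']]
  else +oo%E.

(* A real-valued infimum is enough: the set is bounded below by 1, and it is
   nonempty whenever phi is superlinear. *)
Definition growth_inv (R : realType) (phi : R -> \bar R) (y : R) : R :=
  inf [set x | 1 <= x /\ (y%:E <= growth phi x)%E].

Section robust_functional.
Context d (T : measurableType d) (R : realType).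
Local Open Scope ereal_scope.

Definition feasible (P : probability T R) (phi : R -> \bar R) (tau : R) :
    set (T -> R) :=
  [set zeta : T -> R | [/\ measurable_fun [set: T] zeta,
                  (forall w, (0 <= zeta w)%R),
                  \int[P]_w (zeta w)%:E = 1 &
                  \int[P]_w phi (zeta w) <= tau%:E]].

Definition robust (P : probability T R) (phi : R -> \bar R) (tau : R)
    (X : T -> R) : \bar R :=
  ereal_sup [set \int[P]_w (X w * zeta w)%:E | zeta in feasible P phi tau].

End robust_functional.

Section product_power.
Context d (T : measurableType d) (R : realType).

Definition tcons n (z : T * n.-tuple T) : n.+1.-tuple T :=
  [tuple of z.1 :: z.2].

Lemma measurable_tcons n : measurable_fun [set: T * n.-tuple T] (@tcons n).
Proof. exact: measurable_cons measurable_fst measurable_snd. Qed.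

HB.instance Definition _ n :=
  isMeasurableFun.Build _ _ _ _ (@tcons n) (@measurable_tcons n).

Fixpoint product_power (P : probability T R) n : probability (n.-tuple T) R :=
  if n is m.+1 then distribution (P \x product_power P m)%E (@tcons m)
  else \d_[tuple].

Lemma product_powerE (P : probability T R) n (A : 'I_n -> set T) :
  (forall i, measurable (A i)) ->
  product_power P n [set t | forall i, A i (tnth t i)]
    = (\prod_(i < n) P (A i))%E.
Proof.
elim: n A => [|n IHn] A mA /=.
  rewrite big_ord0 diracE mem_set//=; by case.
rewrite /distribution /pushforward big_ord_recl -IHn//.
rewrite -product_measure1E//; last first.
  rewrite [X in measurable X](_ : _ =
      \bigcap_(i in [set: 'I_n]) ((@tnth n T)^~ i @^-1` A (lift ord0 i))).
    apply: fin_bigcap_measurable => // i _.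
    by rewrite -[X in measurable X]setTI; exact: measurable_tnth.
  by apply/seteqP; split=> [t At i _|t At i]; [exact: At|exact: At i I].
congr ((_ \x _)%E _); apply/seteqP; split=> [[x t]|[x t]] /=.
  move=> At; split=> [|i]; first exact: At ord0.
  by have := At (lift ord0 i); rewrite /tcons tnthS.
case=> A0 At i; case: (unliftP ord0 i) => [j|] ->; last exact: A0.
by rewrite /tcons tnthS.
Qed.

End product_power.

(* Main.v *)
(* Le Cam's two-point method. With [y = tau B / (2 eps)], [G = growth_inv phi y]
   and [p = (eps / B) / G], compare [P0 = bernoulli_prob 0], whose robust value
   is 0, with [P1 = bernoulli_prob p]. Lower semicontinuity gives
   [phi G <= y G], so the likelihood ratio equal to [G] at [true] is feasible
   for [P1] and shows that the robust value is at least [B p G = eps]. As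
   [n p <= 1/2], the sample with no [true] has probability 1 under [P0] and at
   least [1 - n p >= 1/2] under [P1], and the single value of the estimator on
   it is off by at least [eps / 2] for one of the two measures. *)
Require Import Defs.
From mathcomp Require Import all_boot all_order all_algebra.
From mathcomp Require Import all_classical all_reals all_analysis.
From mathcomp Require Import measurable_realfun ring lra.
Import Order.TTheory GRing.Theory Num.Theory.
Import numFieldNormedType.Exports.
Local Open Scope classical_set_scope.
Local Open Scope ring_scope.

(** * Growth function, its inverse, and convexity bounds for [phi] *)

Lemma growth_geP (R : realType) (phi : R -> \bar R) (x y : R) : 1 <= x ->
  (y%:E <= growth phi x)%E <->
  (forall x', x <= x' -> ((y * x')%:E <= phi x')%E).
Proof.
move=> x1; rewrite /growth x1; split=> [yg x' xx'|yphi].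
  have x'0 : 0 < x' by apply: lt_le_trans xx'; lra.
  rewrite EFinM -lee_pdivlMr//; apply: le_trans yg _.
  apply: ereal_inf_lbound; exists x' => //.
  by rewrite inver gt_eqF.
apply: le_ereal_inf_tmp => _ [x' /= xx' <-].
have x'0 : 0 < x' by apply: lt_le_trans xx'; lra.
by rewrite inver gt_eqF// lee_pdivlMr// -EFinM; exact: yphi.
Qed.

(** The real [inf] of an empty set is 0 by default; a point in the level set makes [growth_inv] a
    true infimum, hence at least 1. *)
Lemma growth_level_nonempty (R : realType) (phi : R -> \bar R) (y : R) :
  superlinear phi -> [set x | 1 <= x /\ (y%:E <= growth phi x)%E] !=set0.
Proof.
move=> /cvgeyPge /(_ y) [M [_ yphi]].
have maxM1 : 1 <= Num.max 1 (M + 1) by rewrite le_max lexx.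
exists (Num.max 1 (M + 1)); split => //.
apply/growth_geP => // x' maxx'.
have x'0 : 0 < x' by apply: lt_le_trans maxx'; lra.
have /yphi : M < x'.
  by apply: lt_le_trans maxx'; rewrite lt_max ltrDl ltr01 orbT.
by rewrite inver gt_eqF// lee_pdivlMr.
Qed.

Lemma growth_inv_ge1 (R : realType) (phi : R -> \bar R) (y : R) :
  superlinear phi -> 1 <= growth_inv phi y.
Proof.
by move=> /growth_level_nonempty S0; apply: lb_le_inf => [|x []//]; exact: S0.
Qed.

(** If [phi] exceeded [y * G] at [G], it would do so near [G]; yet just below [G] the level [y] is
    not reached, which yields a nearby [x'] with [phi x' < y * x' <= y * G]. *)
Lemma divergence_growth_inv (R : realType) (phi : R -> \bar R) (y : R) :
  divergence_function phi -> superlinear phi -> 0 <= y ->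
  (phi (growth_inv phi y) <= (y * growth_inv phi y)%:E)%E.
Proof.
move=> phi_div /[dup] phi_sl /(growth_level_nonempty _ _ y) S0 y0.
have := growth_inv_ge1 _ _ y phi_sl; set G := growth_inv phi y.
rewrite le_eqVlt => /predU1P[<-|G1].
  by rewrite divergence1// mulr1 lee_fin.
rewrite leNgt; apply/negP => /(divergence_lsc phi_div)[V].
move=> /nbhs_ballP[e /= e0 eV] yGphi.
(* The maximum with 1 keeps the point where [growth] is the infimum, still within [e / 2] of [G]. *)
have xG : Num.max 1 (G - e / 2) < G by rewrite gt_max G1 /=; lra.
set x := Num.max 1 (G - e / 2) in xG.
have x1 : 1 <= x by rewrite le_max lexx.
have Gex : G - e / 2 <= x by rewrite le_max lexx orbT.
have : ~ (y%:E <= growth phi x)%E.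
  move=> yx; suff : G <= x by rewrite leNgt xG.
  by apply: ge_inf => //; exists 1 => z [].
rewrite growth_geP// -existsNP => -[x' /not_implyP[xx' /negP]].
rewrite -ltNge => phix'.
(* Were [x'] beyond [G], a point of the level set would lie below it and force
   [phi x' >= y * x']. *)
have x'G : x' <= G.
  rewrite leNgt; apply/negP => /(inf_lt S0)[z [z1 /growth_geP-/(_ z1) yz]] zx'.
  by have := yz x' (ltW zx'); rewrite leNgt phix'.
have /yGphi : V x'.
  apply: eV; rewrite -ball_normE /= ger0_norm ?subr_ge0//; lra.
rewrite ltNge => /negP; apply; apply: le_trans (ltW phix') _.
by rewrite lee_fin ler_wpM2l.
Qed.

(** Convexity puts [phi] below its chord from [1 - d], with value [c], to 1, with value 0. *)
Lemma divergence_left1 (R : realType) (phi : R -> \bar R) (d c z : R) :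
  divergence_function phi -> 0 < d -> phi (1 - d) = c%:E ->
  1 - d <= z <= 1 -> (phi z <= ((1 - z) / d * c)%:E)%E.
Proof.
move=> phi_div d0 phic /andP[dz z1].
have t01 : 0 <= (1 - z) / d <= 1.
  by rewrite divr_ge0 ?subr_ge0 ?(ltW d0)//= ler_pdivrMr// mul1r; lra.
have := divergence_convex phi_div (1 - d) 1 t01.
rewrite divergence1// mule0 adde0 phic -EFinM.
suff -> : (1 - z) / d * (1 - d) + (1 - (1 - z) / d) * 1 = z by [].
by field; rewrite gt_eqF.
Qed.

(** * Robust values under Bernoulli measures *)

Lemma bernoulli_prob_true (R : realType) (p : R) : 0 <= p <= 1 ->
  bernoulli_prob p [set true] = p%:E.
Proof.
by move=> p01; rewrite bernoulli_probE// !diracE mem_set// memNset// mule1 mule0 adde0.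
Qed.

Lemma bernoulli_prob_false (R : realType) (p : R) : 0 <= p <= 1 ->
  bernoulli_prob p [set false] = (1 - p)%:E.
Proof.
by move=> p01; rewrite bernoulli_probE// !diracE memNset// mem_set// mule1 mule0 add0e.
Qed.

Lemma robust_bernoulli_ge (R : realType) (phi : R -> \bar R)
    (tau p z1 z2 : R) (X : bool -> R) :
  (forall x, 0 <= phi x)%E -> 0 <= p <= 1 -> 0 <= X true -> X false = 0 ->
  0 <= z1 -> 0 <= z2 -> p * z1 + (1 - p) * z2 = 1 ->
  (p%:E * phi z1 + (1 - p)%:E * phi z2 <= tau%:E)%E ->
  ((p * (X true * z1))%:E <= robust (bernoulli_prob p) phi tau X)%E.
Proof.
move=> phi0 p01 Xt Xf z10 z20 sum1 phitau.
pose zeta (w : bool) : R := if w then z1 else z2.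
apply: ereal_sup_ubound; exists zeta.
  split=> //; first by case.
  - by rewrite integral_bernoulli_prob//= => [|[]]; rewrite ?lee_fin// -sum1.
  - by rewrite integral_bernoulli_prob.
rewrite integral_bernoulli_prob//= => [|[]]; rewrite ?lee_fin ?Xf ?mul0r ?mulr_ge0//.
by rewrite mule0 adde0.
Qed.

(** All mass sits at [false], where [X] vanishes; the constant ratio 1 is feasible, so the supremum
    is not over the empty set. *)
Lemma robust_bernoulli0 (R : realType) (phi : R -> \bar R) (tau : R)
    (X : bool -> R) :
  divergence_function phi -> 0 <= tau -> 0 <= X true -> X false = 0 ->
  robust (bernoulli_prob 0) phi tau X = 0%E.
Proof.
move=> phi_div tau0 Xt Xf; have p01 : 0 <= (0 : R) <= 1 by lra.
apply/eqP; rewrite eq_le; apply/andP; split.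
  apply: ge_ereal_sup => _ [zeta [_ zeta0 _ _] <-].
  rewrite integral_bernoulli_prob => // [|[]].
  - by rewrite Xf mul0r mule0 mul0e adde0.
  - by rewrite lee_fin mulr_ge0.
  - by rewrite Xf mul0r.
rewrite -[leLHS]/(0%:E) -[0 in leLHS](mul0r (X true * 1)).
apply: (@robust_bernoulli_ge _ _ _ _ _ 1) => //; first exact: divergence_ge0.
  by rewrite mul0r add0r subr0 mulr1.
by rewrite !divergence1// !mule0 adde0 lee_fin.
Qed.

(** * Probability of the all-[false] sample *)

Lemma product_power_nseq_false (R : realType) (p : R) n : 0 <= p <= 1 ->
  measurable [set w : n.-tuple bool | forall i, tnth w i = false] /\
  product_power (bernoulli_prob p) n [set w | forall i, tnth w i = false]
    = ((1 - p) ^+ n)%:E.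
Proof.
move=> p01; split.
  rewrite [X in measurable X](_ : _ =
      \bigcap_(i in [set: 'I_n]) ((@tnth n bool)^~ i @^-1` [set false])).
    apply: fin_bigcap_measurable => // i _.
    by rewrite -[X in measurable X]setTI; exact: measurable_tnth.
  by apply/seteqP; split=> [t At i _|t At i]; [exact: At|exact: At i I].
rewrite (product_powerE (bernoulli_prob p) (A := fun=> [set false]))//.
under eq_bigr do rewrite /= bernoulli_prob_false//.
by rewrite prodEFin prodr_const card_ord.
Qed.

Lemma bernoulli_ineq (R : realType) (p : R) n : 0 <= p <= 1 ->
  1 - n%:R * p <= (1 - p) ^+ n.
Proof.
move=> /andP[p0 p1]; elim: n => [|n IHn]; first by rewrite mul0r subr0 expr0.
rewrite exprS -natr1.
have : (1 - p) * (1 - n%:R * p) <= (1 - p) * (1 - p) ^+ n.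
  by rewrite ler_wpM2l// subr_ge0.
apply: le_trans; have : 0 <= n%:R * p ^+ 2 by rewrite mulr_ge0// sqr_ge0.
nra.
Qed.

Lemma product_power_deviation (R : realType) (p eps : R) n
    (Rhat : n.-tuple bool -> R) (r : \bar R) :
  0 <= p <= 1 -> n%:R * p <= 1 / 2 ->
  measurable_fun [set: n.-tuple bool] Rhat ->
  ((eps / 2)%:E <= `|(Rhat [tuple of nseq n false])%:E - r|)%E ->
  ((1 / 4)%:E <= product_power (bernoulli_prob p) n
     [set w | (eps / 2)%:E <= `|(Rhat w)%:E - r|])%E.
Proof.
move=> p01 np mRhat dev; have [mA PA] := product_power_nseq_false _ p n p01.
have half : ((1 / 4)%:E <= ((1 - p) ^+ n)%:E :> \bar R)%E.
  by rewrite lee_fin; apply: le_trans (bernoulli_ineq _ _ n p01); lra.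
apply: le_trans half _; rewrite -PA; apply: le_measure; rewrite ?inE//.
  rewrite -[X in measurable X]setTI; apply: emeasurable_fun_c_infty => //.
  apply: measurableT_comp => //; apply: emeasurable_funB => //.
  exact/measurable_EFinP.
move=> w /= wF; suff -> : w = [tuple of nseq n false] by [].
by apply: eq_from_tnth => i; rewrite wF tnth_nseq.
Qed.

(** * Calibration of the rare event and the two-point argument *)

(* The likelihood ratio [zeta] equal to [growth_inv phi y] at [true]: the two
   halves of the budget [tau] pay for [phi (zeta true)] and, [zeta false] being
   close to 1, for [phi (zeta false)]. *)
Lemma robust_bernoulli_growth_inv (R : realType) (phi : R -> \bar R)
    (tau d c B eps p : R) (X : bool -> R) :
  divergence_function phi -> superlinear phi -> 0 < tau -> 0 < d -> 0 <= c ->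
  phi (1 - d) = c%:E -> d <= 1 ->
  0 < eps -> eps <= 1 / 2 -> eps <= d / 2 -> eps * (4 * (c + 1)) <= d * tau ->
  1 <= B -> X true = B -> X false = 0 ->
  p = eps / B / growth_inv phi (tau * B / (2 * eps)) ->
  0 <= p <= 1 /\ (eps%:E <= robust (bernoulli_prob p) phi tau X)%E.
Proof.
move=> phi_div phi_sl tau0 d0 c0 phic d1 eps0 eps_half eps_d eps_tau B1 XB Xf.
set y := tau * B / (2 * eps); set G := growth_inv phi y => pE.
have B0 : 0 < B by lra.
have y0 : 0 <= y by rewrite divr_ge0 ?mulr_ge0; lra.
have G1 : 1 <= G by exact: growth_inv_ge1.
have G0 : 0 < G by lra.
have pG : p * G = eps / B by rewrite pE; field; rewrite !gt_eqF.
have epsB0 : 0 < eps / B by rewrite divr_gt0.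
have epsB : eps / B <= eps by rewrite ler_pdivrMr//; nra.
have p0 : 0 < p by rewrite pE divr_gt0.
have ppG : p <= p * G by nra.
have p1 : p <= 1 / 2 by lra.
have p01 : 0 <= p <= 1 by lra.
(* The value at [false] is forced by total mass 1. Below, [1 - z = p * (G - 1) / (1 - p)] is at most
   [2 * eps], as [p * G <= eps] and [p <= 1 / 2]. *)
split=> //; pose z := (1 - p * G) / (1 - p).
have zE : (1 - p) * z = 1 - p * G by rewrite /z; field; lra.
have z1 : z <= 1 by nra.
have z_eps : 1 - z <= 2 * eps by nra.
have zd : 1 - d <= z by lra.
have := @robust_bernoulli_ge _ phi tau p G z X.
have -> : p * (X true * G) = eps by rewrite XB mulrCA pG; field; rewrite gt_eqF.
apply=> //; [exact: divergence_ge0|lra|lra|lra|lra|].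
have phiG : (p%:E * phi G <= (tau / 2)%:E)%E.
  (* The level [y] is calibrated to make this an equality. *)
  have -> : tau / 2 = p * (y * G).
    by rewrite mulrCA pG /y; field; rewrite !gt_eqF.
  by rewrite EFinM lee_wpmul2l ?lee_fin ?(ltW p0)//; exact: divergence_growth_inv.
have phiz : ((1 - p)%:E * phi z <= (tau / 2)%:E)%E.
  apply: (@le_trans _ _ (phi z)).
    rewrite -[leRHS]mul1e; apply: lee_wpmul2r; last by rewrite lee_fin; lra.
    exact: divergence_ge0.
  (* The chord bound is at most [2 * eps * c / d], hence at most [tau / 2] by [eps_tau]. *)
  apply: le_trans (divergence_left1 _ _ d c z phi_div d0 phic _) _; first lra.
  rewrite lee_fin mulrAC ler_pdivrMr//; nra.
apply: le_trans (leeD phiG phiz) _.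
by rewrite -EFinD lee_fin; lra.
Qed.

(* The two-point space {omega_1, omega_2} is bool, with omega_1 = true and
   omega_2 = false; every subset of bool is measurable. *)
Theorem theorem3p1 (R : realType) (phi : R -> \bar R) (tau : R)
    (phi_div : divergence_function phi)
    (phi_int : exists2 delta : R, 0 < delta &
       `[1 - delta, 1 + delta] `<=` (edom phi)°)
    (phi_superlinear : superlinear phi)
    (tau_gt0 : 0 < tau) :
  exists2 eps0 : R, 0 < eps0 &
  forall (B : R) (X : bool -> R), 1 <= B -> X true = B -> X false = 0 ->
    (forall eps : R, 0 < eps < eps0 ->
       exists P : probability bool R,
         (eps%:E <= robust P phi tau X)%E /\
         P [set true] =
           ((eps / B) / growth_inv phi (tau * B / (2 * eps)))%:E) /\
    (forall (eps : R) (n : nat) (Rhat : n.-tuple bool -> R),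
       0 < eps < eps0 -> (0 < n)%N ->
       n%:R <= growth_inv phi (tau * B / (2 * eps)) * B / (2 * eps) ->
       measurable_fun [set: n.-tuple bool] Rhat ->
       exists P : probability bool R,
         ((1 / 4)%:E <= product_power P n
            [set w | (eps / 2)%:E <= `|(Rhat w)%:E - robust P phi tau X|])%E).
Proof.
case: phi_int => d d0 /(_ (1 - d)) /= dint.
have /interior_subset : (edom phi)° (1 - d).
  by apply: dint; rewrite in_itv /= lexx; lra.
rewrite /edom /= => phid_lty.
have [c c0 phic] : exists2 c : R, 0 <= c & phi (1 - d) = c%:E.
  have := divergence_ge0 phi_div (1 - d).
  by case: (phi (1 - d)) phid_lty => // c _ c0; exists c.
have d1 : d <= 1.
  rewrite -subr_ge0 leNgt; apply/negP => /(divergence_neg phi_div).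
  by rewrite phic.
(* The three bounds serve in turn for [p <= 1 / 2], [z >= 1 - d] and [phi z <= tau / 2]; none
   involves [B], and [c + 1] avoids dividing by 0 when [c = 0]. *)
pose eps0 := Num.min (1 / 2) (Num.min (d / 2) (d * tau / (4 * (c + 1)))).
have eps0P eps : 0 < eps < eps0 -> [/\ 0 < eps, eps <= 1 / 2, eps <= d / 2 &
    eps * (4 * (c + 1)) <= d * tau].
  rewrite !lt_min => /andP[e0 /and3P[/ltW e1 /ltW e2 /ltW]].
  by rewrite ler_pdivlMr; [split|lra].
exists eps0.
  rewrite !lt_min; apply/and3P; split; [lra|lra|].
  by rewrite divr_gt0 ?mulr_gt0//; lra.
move=> B X B1 XB Xf.
have key eps (eps_lt : 0 < eps < eps0) :
    let p := eps / B / growth_inv phi (tau * B / (2 * eps)) in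
    0 <= p <= 1 /\ (eps%:E <= robust (bernoulli_prob p) phi tau X)%E.
  have [e0 e1 e2 e3] := eps0P _ eps_lt.
  exact: (robust_bernoulli_growth_inv _ _ _ d c B).
split=> [eps /key[]|eps n Rhat eps_lt _ nG mRhat].
  set p := _ / growth_inv _ _ => p01 epsR.
  by exists (bernoulli_prob p); split=> //=; rewrite bernoulli_prob_true.
have [e0 _ _ _] := eps0P _ eps_lt.
have /= [] := key _ eps_lt; set y := tau * B / (2 * eps) in nG *.
have G1 := growth_inv_ge1 _ _ y phi_superlinear.
set G := growth_inv phi y in nG G1 *.
set p := eps / B / G => p01 epsR.
have B0 : 0 < B by lra.
have np : n%:R * p <= 1 / 2.
  have -> : 1 / 2 = G * B / (2 * eps) * p.
    by rewrite /p; field; rewrite !gt_eqF//; lra.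
  by apply: ler_wpM2r nG; case/andP: p01.
set r := Rhat [tuple of nseq n false].
(* A small [r] misses the robust value under [bernoulli_prob p], which is at least [eps] (the type
   also admits [+oo]); a large one misses the value 0 under [bernoulli_prob 0]. *)
have [r_small|r_big] := ltP `|r| (eps / 2).
  exists (bernoulli_prob p); apply: product_power_deviation => //.
  rewrite -/r; case: (robust _ _ _ _) epsR => [s epss|_|//]; last by rewrite leey.
  rewrite lee_fin distrC; rewrite lee_fin in epss.
  apply: le_trans (ler_norm _); move: r_small; rewrite ltr_norml; lra.
exists (bernoulli_prob 0); apply: product_power_deviation => //.
- lra.
- rewrite mulr0; lra.
- by rewrite (robust_bernoulli0 _ _ _ _ phi_div (ltW tau_gt0)) ?XB ?(ltW B0)// sube0.
Qed.
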